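(* Let $n$ be a positive integer. Consider all simple jump paths in dimension $2$ from $(n+1,n+1)$ to $(0,0)$, and the multiset of all gap vectors occurring in all of these paths (each path contributing one gap vector per step). For fixed positive integers $v_1,v_2$, let $P_n(v_1,v_2)$ be the number of gap vectors equal to $(v_1,v_2)$ in this multiset divided by the total number of gap vectors in this multiset. Then \[\lim_{n\to\infty} P_n(v_1,v_2) \;=\; \frac{1}{2^{v_1+v_2}}.\]
   Context: A simple jump path in dimension $2$ of length $k$ starting at $(a_1,a_2)$ (with $a_1,a_2$ positive integers) is a sequence of lattice points $(x_{0,1},x_{0,2}),\dots,(x_{k,1},x_{k,2})$ in $\mathbb{Z}_{\ge 0}^2$ with $(x_{0,1},x_{0,2})=(a_1,a_2)$, $(x_{k,1},x_{k,2})=(0,0)$, and $x_{i,j}>x_{i+1,j}$ for all $i\in\{0,\dots,k-1\}$ and $j\in\{1,2\}$ (every step strictly decreases both coordinates). Each step from $(x_{i,1},x_{i,2})$ to $(x_{i+1,1},x_{i+1,2})$ has gap vector $(x_{i,1}-x_{i+1,1},\,x_{i,2}-x_{i+1,2})$; a path of length $k$ thus has $k$ gap vectors (including the final step into the origin). *)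

(* Defs.v *)
From HB Require Import structures.
From mathcomp Require Import all_boot all_order all_algebra.
From mathcomp Require Import all_classical all_reals all_analysis.

Set Implicit Arguments.
Unset Strict Implicit.
Unset Printing Implicit Defensive.

Import Order.TTheory GRing.Theory Num.Theory.
Import numFieldNormedType.Exports.

Definition point : Type := (nat * nat)%type.

Definition jump : rel point := fun x y => (y.1 < x.1)%N && (y.2 < x.2)%N.

(* A path x_0, ..., x_k is the sequence of its k + 1 points. *)
Definition simple_jump_path (a : point) (p : seq point) : bool :=
  if p is x :: q then [&& x == a, last x q == (0%N, 0%N) & path jump x q]
  else false.

(* The truncated subtractions are exact when jump x y. *)
Definition gap (x y : point) : point := ((x.1 - y.1)%N, (x.2 - y.2)%N).

Definition gaps (p : seq point) : seq point :=
  if p is x :: q then pairmap gap x q else [::].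

Definition point_of_ord (a : point) (u : 'I_a.1.+1 * 'I_a.2.+1) : point :=
  (val u.1, val u.2).

(* A path from a has at most a.1 steps and stays in the box [0, a.1] x [0, a.2],
   so the filtered sequences are all the paths from a, each of them once: see
   mem_simple_jump_paths and uniq_simple_jump_paths. *)
Definition simple_jump_paths (a : point) : seq (seq point) :=
  [seq p <- [seq map (@point_of_ord a) (tval t)
               | k <- iota 1 a.1.+1,
                 t <- enum {: k.-tuple ('I_a.1.+1 * 'I_a.2.+1)}]
     | simple_jump_path a p].

Lemma point_of_ord_inj (a : point) : injective (@point_of_ord a).
Proof. by move=> [u1 u2] [w1 w2] [] /val_inj -> /val_inj ->. Qed.

Lemma path_jump_bound (x : point) (q : seq point) : path jump x q ->
  (size q <= x.1)%N && all (fun y => (y.1 <= x.1)%N && (y.2 <= x.2)%N) q.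
Proof.
elim: q x => //= y q IHq x /andP[/andP[lt1 lt2] /IHq /andP[sz_q /allP le_q]].
rewrite (leq_ltn_trans sz_q lt1) (ltnW lt1) (ltnW lt2) /=.
apply/allP=> z /le_q /andP[z1 z2].
by rewrite (leq_trans z1 (ltnW lt1)) (leq_trans z2 (ltnW lt2)).
Qed.

Lemma mem_simple_jump_paths (a : point) (p : seq point) :
  (p \in simple_jump_paths a) = simple_jump_path a p.
Proof.
rewrite mem_filter; apply: andb_idr.
case: p => // x q /and3P[/eqP -> _ /path_jump_bound].
move=> /andP[sz_q /allP le_q].
pose f (y : point) : 'I_a.1.+1 * 'I_a.2.+1 := (inord y.1, inord y.2).
apply/allpairsPdep.
exists (size (a :: q)), (map_tuple f (in_tuple (a :: q))); split.
- by rewrite mem_iota /= add1n !ltnS.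
- by rewrite mem_enum.
- rewrite /= -map_comp; congr cons.
    by rewrite /point_of_ord /= !inordK //; case: (a).
  rewrite -[LHS]map_id; apply/eq_in_map => y /le_q /andP[y1 y2].
  by rewrite /point_of_ord /= !inordK // ?ltnS //; case: (y).
Qed.

Lemma uniq_simple_jump_paths (a : point) : uniq (simple_jump_paths a).
Proof.
apply: filter_uniq; apply: allpairs_uniq_dep.
- exact: iota_uniq.
- by move=> k _; apply: enum_uniq.
- move=> [k t] [l s] _ _ /= /(inj_map (@point_of_ord_inj a)) eq_ts.
  have eq_kl : k = l by rewrite -(size_tuple t) eq_ts size_tuple.
  by case: l / eq_kl s eq_ts => s /val_inj ->.
Qed.

(* The multiset of the gap vectors of all the paths from a, as a sequence. *)
Definition gap_vectors (a : point) : seq point :=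
  flatten [seq gaps p | p <- simple_jump_paths a].

Definition gap_proportion (R : realType) (n : nat) (v : point) : R :=
  ((count_mem v (gap_vectors (n.+1, n.+1)))%:R
     / (size (gap_vectors (n.+1, n.+1)))%:R)%R.

(* Main.v *)
(* Deleting a gap v from a path from a, and translating by v the points before
   it, gives a path from a - v with a marked point, and this is a bijection.
   Hence the gap v occurs as often in the paths from a as there are points in
   all the paths from a - v. From (i+1, j+1) there are C(i+j, i) paths, with
   C(i+j, i) (1 + ij/(i+j)) steps in total, so with i = n - v1, j = n - v2 the
   proportion is
     C(i+j, i)/C(2n, n) * (2 + ij/(i+j))/(1 + n/2),
   whose first factor tends to 2^-(v1+v2) and whose second one tends to 1. *)
Require Import Defs.
From mathcomp Require Import all_boot all_order all_algebra.
From mathcomp Require Import all_classical all_reals all_analysis.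
From mathcomp Require Import zify ring lra.
Import Order.TTheory GRing.Theory Num.Theory.
Import numFieldNormedType.Exports.
Local Open Scope classical_set_scope.
Local Open Scope ring_scope.

(** * Closed forms on rectangles of starting points *)

(* The number of paths from (i, j). *)
Definition path_count (i j : nat) : nat :=
  match i, j with
  | 0, 0 => 1
  | i'.+1, j'.+1 => 'C(i' + j', i')
  | _, _ => 0
  end%N.

(* The total number of steps of the paths from (i, j). *)
Definition step_count (i j : nat) : nat :=
  match i, j with
  | i'.+1, j'.+1 => 'C(i' + j', i') + i' * 'C((i' + j').-1, i')
  | _, _ => 0
  end%N.

(** Since [f] is the mixed second difference of [F] and [F] vanishes on both axes, the double sum
    telescopes. *)
Lemma sum_rect (f F : nat -> nat -> nat) :
    (forall i, F i 0 = 0)%N -> (forall j, F 0 j = 0)%N ->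
    (forall i j, F i.+1 j.+1 + F i j = F i.+1 j + F i j.+1 + f i j)%N ->
  forall i j, (\sum_(x < i) \sum_(y < j) f x y = F i j)%N.
Proof.
move=> Fi0 F0j F_rec; elim=> [|i IHi] j; first by rewrite big_ord0 F0j.
rewrite big_ord_recr /= IHi; elim: j => [|j IHj]; first by rewrite big_ord0 !Fi0.
by rewrite big_ord_recr /=; have := F_rec i j; lia.
Qed.

Lemma sum_path_count (i j : nat) :
  (\sum_(x < i.+1) \sum_(y < j.+1) path_count x y = path_count i.+1 j.+1)%N.
Proof.
(* The value 1 at the origin would break the boundary condition of [sum_rect]. Off the axes the
   recurrence is Pascal's rule. *)
pose F x y := if (x, y) is (0, 0)%N then 0%N else path_count x y.
rewrite (@sum_rect _ F) => [//|[]|[]|[|x] [|y]] //.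
- by rewrite /F /= !add0n !bin0.
- by rewrite /F /= !addn0 !binn.
- by rewrite /F /= !addnS !addSn !binS; lia.
Qed.

(** Each step of a path from (i, j) ends at a point of its tail, and the tails are the paths from
    the points of the rectangle. The proof only checks the recurrence. *)
Lemma sum_point_count (i j : nat) :
  (\sum_(x < i) \sum_(y < j) (path_count x y + step_count x y)
     = step_count i j)%N.
Proof.
apply: (sum_rect (fun x y => path_count x y + step_count x y)%N) => [[]|[]|[|x] [|y]] //.
- by rewrite /= !add0n !bin0.
(* For [x] = 0 the truncated [.-1] makes a binomial 1 instead of 0, but its factor [x] is 0. *)
- by rewrite /= !addn0 /= !binn; case: x => //= x; rewrite !bin_small //; lia.
- by rewrite /= !addnS !addSn /= !binS; lia.
Qed.

(** * Recursion on the first jump *)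

Lemma sum_simple_jump_pathsS (F : seq Defs.point -> nat) (i j : nat) :
  (\sum_(p <- simple_jump_paths (i.+1, j.+1)) F p =
   \sum_(x < i.+1) \sum_(y < j.+1) \sum_(p <- simple_jump_paths (x : nat, y : nat))
     F ((i.+1, j.+1) :: p))%N.
Proof.
pose a : Defs.point := (i.+1, j.+1).
pose B := [seq (x, y) | x <- index_iota 0 i.+1, y <- index_iota 0 j.+1].
pose s := flatten [seq map (cons a) (simple_jump_paths b) | b <- B].
have memB b : (b \in B) = jump a b.
  case: b => b1 b2; rewrite /jump /=; apply/allpairsP/idP.
    by case=> -[x y] []; rewrite !mem_index_iota /= => ? ? [-> ->]; apply/andP.
  by case/andP=> b1i b2j; exists (b1, b2); rewrite !mem_index_iota.
have perm_s : perm_eq (simple_jump_paths a) s.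
  apply: uniq_perm; first exact: uniq_simple_jump_paths.
    apply: allpairs_uniq_dep.
    - by apply: allpairs_uniq; rewrite ?iota_uniq // => -[? ?] [? ?] _ _ [-> ->].
    - by move=> b _; apply: uniq_simple_jump_paths.
    (* A tail determines the point where it starts, so no path is listed twice. *)
    move=> [b p] [b' p'] /allpairsPdep[c [q [_ + [-> ->]]]].
    move=> + /allpairsPdep[c' [q' [_ + [-> ->]]]] [qq'].
    rewrite -{}qq' !mem_simple_jump_paths.
    by case: q => // y q /andP[/eqP <- _] /andP[/eqP <- _].
  move=> p; rewrite mem_simple_jump_paths; apply/idP/allpairsPdep.
    case: p => //= x [|y q] /and3P[/eqP -> //= last_q /andP[ay path_q]].
    exists y, (y :: q); rewrite memB mem_simple_jump_paths /= eqxx last_q path_q.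
    by rewrite ay.
  case=> b [q [+ + ->]]; rewrite memB mem_simple_jump_paths.
  by case: q => // y q ab /and3P[/eqP -> last_q path_q]; rewrite /= eqxx last_q ab.
rewrite (perm_big _ perm_s) big_allpairs_dep big_allpairs_dep big_mkord.
by apply: eq_bigr => x _; rewrite big_mkord.
Qed.

Lemma simple_jump_paths00 : simple_jump_paths (0, 0)%N = [:: [:: (0, 0)%N]].
Proof.
apply: perm_small_eq => //; apply: uniq_perm => //.
  exact: uniq_simple_jump_paths.
move=> p; rewrite mem_simple_jump_paths inE.
case: p => [|x [|y q]] //=; first by rewrite andbT eqseq_cons andbT; case: eqP => // ->.
by apply/and3P/eqP => // -[/eqP -> _ /andP[]].
Qed.

Lemma simple_jump_paths_axis (a : Defs.point) :
  a != (0, 0)%N -> (a.1 == 0)%N || (a.2 == 0)%N -> simple_jump_paths a = [::].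
Proof.
move=> a0 axis; case E: (simple_jump_paths a) => [//|p s].
have : p \in simple_jump_paths a by rewrite E mem_head.
rewrite mem_simple_jump_paths; case: p {E} => [//|x [|y q]] /and3P[/eqP ->].
  by rewrite /= (negPf a0).
by move=> _ /= /andP[/andP[]]; case/orP: axis => /eqP ->.
Qed.

Lemma size_simple_jump_paths (a : Defs.point) :
  size (simple_jump_paths a) = path_count a.1 a.2.
Proof.
case: a => i j; elim/ltn_ind: i j => -[|i] IH [|j].
- by rewrite simple_jump_paths00.
- by rewrite simple_jump_paths_axis.
- by rewrite simple_jump_paths_axis.
rewrite -sum1_size sum_simple_jump_pathsS -sum_path_count.
apply: eq_bigr => x _; apply: eq_bigr => y _; rewrite sum1_size.
exact: IH.
Qed.

Lemma count_gap_vectors (P : pred Defs.point) (a : Defs.point) :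
  count P (gap_vectors a) = (\sum_(p <- simple_jump_paths a) count P (gaps p))%N.
Proof. by rewrite count_flatten sumnE !big_map. Qed.

(** All paths whose first jump lands on (x, y) share their first gap, hence the factor
    [path_count x y]; the later gaps are those of the tails. *)
Lemma count_gap_vectorsS (P : pred Defs.point) (i j : nat) :
  (count P (gap_vectors (i.+1, j.+1)) =
   \sum_(x < i.+1) \sum_(y < j.+1)
     (P (i.+1 - x, j.+1 - y) * path_count x y
        + count P (gap_vectors (x : nat, y : nat))))%N.
Proof.
rewrite count_gap_vectors sum_simple_jump_pathsS.
apply: eq_bigr => x _; apply: eq_bigr => y _.
rewrite -(size_simple_jump_paths (_, _)) -sum1_size big_distrr /= count_gap_vectors.
rewrite -big_split /= !big_seq; apply: eq_bigr => p.
rewrite mem_simple_jump_paths muln1.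
by case: p => // z q /andP[/eqP -> _].
Qed.

Lemma count_gap_vectors_axis (P : pred Defs.point) (a : Defs.point) :
  (a.1 == 0)%N || (a.2 == 0)%N -> count P (gap_vectors a) = 0%N.
Proof.
rewrite count_gap_vectors; have [->|a0] := eqVneq a (0, 0)%N.
  by rewrite simple_jump_paths00 big_seq1.
by move/simple_jump_paths_axis => -> //; rewrite big_nil.
Qed.

Lemma size_gap_vectors (a : Defs.point) : size (gap_vectors a) = step_count a.1 a.2.
Proof.
rewrite -count_predT; case: a => i j; elim/ltn_ind: i j => -[|i] IH [|j].
1-3: by rewrite count_gap_vectors_axis.
rewrite count_gap_vectorsS -sum_point_count.
apply: eq_bigr => x _; apply: eq_bigr => y _.
by rewrite mul1n IH.
Qed.

Lemma sum_shift (v n : nat) (f : nat -> nat) : (v <= n)%N ->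
  (\sum_(x < n | v <= x) f (x - v) = \sum_(x < n - v) f x)%N.
Proof.
move=> vn; rewrite -(big_mkord (fun x => v <= x)%N (fun x => f (x - v)%N)).
rewrite (big_cat_nat _ vn) //= big_nat_cond big_pred0 ?add0n => [|x]; last by lia.
rewrite -{1}[v]add0n big_addn big_mkord.
by apply: eq_big => x; rewrite ?addnK // leq_addl.
Qed.

(** The bijection is replaced by an induction on [a]: the occurrences of [v] as first gap give the
    [path_count] term, and the later ones, by induction and [sum_point_count], the [step_count]
    term. *)
Lemma count_mem_gap_vectors (v a : Defs.point) : (0 < v.1)%N -> (0 < v.2)%N ->
  count_mem v (gap_vectors a) =
    (if (v.1 <= a.1) && (v.2 <= a.2)
     then path_count (a.1 - v.1) (a.2 - v.2) + step_count (a.1 - v.1) (a.2 - v.2)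
     else 0)%N.
Proof.
case: v a => [v w] [i j] /= v0 w0; elim/ltn_ind: i j => -[|i] IH [|j].
1-3: by rewrite count_gap_vectors_axis //; case: ifP => //; lia.
rewrite count_gap_vectorsS.
under eq_bigr => x _ do rewrite big_split /=.
rewrite big_split /=.
case: ifPn => [/andP[vi wj]|vw]; last first.
  rewrite !big1 // => x _; rewrite big1 // => y _.
    by rewrite IH //; case: ifP => //; have := ltn_ord x; have := ltn_ord y; lia.
  by case: eqP => // -[]; have := ltn_ord x; have := ltn_ord y; lia.
congr addn.
  (* The only landing point with first gap (v, w); it lies in the summation range because [v] and
     [w] are positive. *)
  have xi : (i.+1 - v < i.+1)%N by lia.
  have yj : (j.+1 - w < j.+1)%N by lia.
  rewrite (bigD1 (Ordinal xi)) //= (bigD1 (Ordinal yj)) //= !subKn // eqxx mul1n.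
  rewrite !big1 ?addn0 // => [x /eqP nx|y /eqP ny].
    rewrite big1 // => y _; case: eqP => // -[ex _]; case: nx; apply: val_inj => /=.
    by have := ltn_ord x; lia.
  case: eqP => // -[ey]; case: ny; apply: val_inj => /=.
  by have := ltn_ord y; lia.
pose f x y := (path_count x y + step_count x y)%N.
rewrite -sum_point_count -(sum_shift v i.+1 (fun x => \sum_(y < _) f x y)%N) //.
rewrite [RHS]big_mkcond; apply: eq_bigr => x _.
case: leqP => [vx|xv]; last by rewrite big1 // => y _; rewrite IH // leqNgt xv.
rewrite -(sum_shift w j.+1 (f (x - v)%N)) // [RHS]big_mkcond.
by apply: eq_bigr => y _; rewrite IH // vx.
Qed.

(** * Limits *)

Lemma cvg_affine_div (R : realType) (a b c d : R) : c != 0 ->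
  (a * n%:R - b) / (c * n%:R - d) @[n --> \oo] --> a / c.
Proof.
move=> c0.
have cvg_affine (x y : R) :
    (x * n%:R - y) / n.+1%:R @[n --> \oo] --> x.
  (* Dividing by n + 1 rather than n keeps the identity valid at n = 0. *)
  have -> : (fun n => (x * n%:R - y) / n.+1%:R) =
            (fun n => x - (x + y) * harmonic n).
    apply/funext => n /=.
    have n1 : n.+1%:R != 0 :> R by rewrite pnatr_eq0.
    by apply: (mulIf n1); rewrite divfK // mulrBl -mulrA mulVf // -natr1; ring.
  rewrite -[X in _ --> X]subr0 -(mulr0 (x + y)).
  apply: cvgB; first exact: cvg_cst.
  by apply: cvgMl_tmp; exact: cvg_harmonic.
have -> : (fun n => (a * n%:R - b) / (c * n%:R - d)) =
    (fun n => ((a * n%:R - b) / n.+1%:R) / ((c * n%:R - d) / n.+1%:R)).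
  apply/funext => n.
  by rewrite invfM invrK mulrACA mulVf ?mulr1 // pnatr_eq0.
by apply: cvgM => //; apply: cvgV.
Qed.

(** Raising v by one multiplies the ratio by (n - v)/(2n - v - w) for large n, which tends to 1/2.
    The symmetry of binomials handles w. *)
Lemma cvg_central_bin_ratio (R : realType) (v w : nat) :
  'C(n - v + (n - w), n - v)%:R / 'C(n + n, n)%:R @[n --> \oo]
    --> ((2 ^+ (v + w))^-1 : R).
Proof.
pose r v w n : R := 'C(n - v + (n - w), n - v)%:R / 'C(n + n, n)%:R.
have rS x y : r x y @ \oo --> ((2 ^+ (x + y))^-1 : R) ->
    r x.+1 y @ \oo --> ((2 ^+ (x.+1 + y))^-1 : R).
  move=> r_cvg.
  pose q n : R := (1 * n%:R - x%:R) / (2 * n%:R - (x + y)%:R).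
  have q_cvg : q n @[n --> \oo] --> (1 / 2 : R) by apply: cvg_affine_div.
  rewrite addSn exprS invfM mulrC -[2^-1]mul1r.
  apply: cvg_trans (cvgM r_cvg q_cvg); apply: near_eq_cvg; near=> n.
  have nx : (x < n)%N by near: n; exact: nbhs_infty_gt.
  have ny : (y < n)%N by near: n; exact: nbhs_infty_gt.
  rewrite /r /q /= mulrAC; congr (_ / _).
  have -> : 1 * n%:R - x%:R = (n - x.+1).+1%:R :> R.
    by rewrite mul1r -natrB 1?ltnW // subnSK.
  have -> : 2 * n%:R - (x + y)%:R = (n - x.+1 + (n - y)).+1%:R :> R.
    by rewrite -natrM -natrB; [congr _%:R; lia | lia].
  rewrite -subnSK // addSn.
  have m0 : (n - x.+1 + (n - y)).+1%:R != 0 :> R by rewrite pnatr_eq0.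
  apply: (mulfI m0).
  by rewrite -natrM mul_bin_diag natrM [LHS]mulrCA [X in _ * X]mulrC divfK // mulrC.
have rC x y : r x y @ \oo --> ((2 ^+ (x + y))^-1 : R) ->
    r y x @ \oo --> ((2 ^+ (y + x))^-1 : R).
  have -> : r y x = r x y; last by rewrite addnC.
  apply/funext => n; rewrite /r addnC -[in LHS]bin_sub ?addnK ?leq_addl //.
have r0 : r 0%N 0%N @ \oo --> ((2 ^+ (0 + 0))^-1 : R).
  have -> : r 0%N 0%N = fun=> 1.
    apply/funext => n; rewrite /r !subn0 divff // pnatr_eq0 -lt0n bin_gt0.
    exact: leq_addl.
  by rewrite addn0 expr0 invr1; exact: cvg_cst.
have r0w : r 0%N w @ \oo --> ((2 ^+ (0 + w))^-1 : R).
  by apply: rC; elim: w => // w; exact: rS.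
by elim: v => // v; exact: rS.
Unshelve. all: by end_near. Qed.

(** Absorption, (i + j) C(i+j-1, i) = j C(i+j, i), pulls out the common binomial. *)
Lemma step_countSS (R : realType) (i j : nat) : (0 < i + j)%N ->
  (step_count i.+1 j.+1)%:R
    = 'C(i + j, i)%:R * (1 + i%:R * j%:R / (i%:R + j%:R)) :> R.
Proof.
move=> ij; have ij0 : (i + j)%:R != 0 :> R by rewrite pnatr_eq0 -lt0n.
have := congr1 (fun n => n%:R : R) (mul_bin_down (i + j) i).
rewrite addKn !natrM => E.
have {E} -> : (step_count i.+1 j.+1)%:R =
    'C(i + j, i)%:R + i%:R * (j%:R * 'C(i + j, i)%:R / (i + j)%:R) :> R.
  by rewrite -E mulrAC divff // mul1r /step_count natrD natrM.
by field; rewrite -natrD.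
Qed.

Theorem theorem1p3 (R : realType) (v1 v2 : nat)
    (hv1 : (0 < v1)%N) (hv2 : (0 < v2)%N) :
  gap_proportion R n (v1, v2) @[n --> \oo] --> (1 / 2 ^+ (v1 + v2) : R).
Proof.
rewrite mul1r.
(* With i = n - v1 and j = n - v2, (2 + ij/(i+j))/(1 + n/2) is [f n + g n * h n], written with the
   signs of [cvg_affine_div]; its limit is 0 + 1/2 * 2 = 1. *)
pose f n : R := (0 * n%:R - (- 2)) / (2^-1 * n%:R - (- 1)).
pose g n : R := (1 * n%:R - v1%:R) / (2 * n%:R - (v1 + v2)%:R).
pose h n : R := (1 * n%:R - v2%:R) / (2^-1 * n%:R - (- 1)).
have half0 : 2^-1 != 0 :> R by rewrite invr_eq0.
have f_cvg : f n @[n --> \oo] --> (0 / 2^-1 : R) by exact: cvg_affine_div.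
have g_cvg : g n @[n --> \oo] --> (1 / 2 : R) by exact: cvg_affine_div.
have h_cvg : h n @[n --> \oo] --> (1 / 2^-1 : R) by exact: cvg_affine_div.
have r_cvg := cvg_central_bin_ratio R v1 v2.
have <- : (2 ^+ (v1 + v2))^-1 * (0 / 2^-1 + 1 / 2 * (1 / 2^-1))
          = (2 ^+ (v1 + v2))^-1 :> R.
  by rewrite -[RHS]mulr1; congr (_ * _); field.
apply: cvg_trans (cvgM r_cvg (cvgD f_cvg (cvgM g_cvg h_cvg))).
apply: near_eq_cvg; near=> n.
have nv1 : (v1 < n)%N by near: n; exact: nbhs_infty_gt.
have nv2 : (v2 < n)%N by near: n; exact: nbhs_infty_gt.
rewrite /gap_proportion size_gap_vectors count_mem_gap_vectors //=.
rewrite !leqW 1?ltnW //= !subSn 1?ltnW //.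
rewrite -/(step_count (_ - _).+1 (_ - _).+1) -/(step_count n.+1 n.+1).
rewrite natrD !step_countSS; [|lia|lia].
rewrite !natrB; [|exact: ltnW..].
have C0 : 'C(n + n, n)%:R != 0 :> R by rewrite pnatr_eq0 -lt0n bin_gt0 leq_addl.
have lt1 : v1%:R < n%:R :> R by rewrite ltr_nat.
have lt2 : v2%:R < n%:R :> R by rewrite ltr_nat.
have n0 : 0 < n%:R :> R by apply: le_lt_trans lt1.
rewrite -[(_ + _) n]/(f n + g n * h n) /f /g /h !natrD.
field.
by apply/and5P; split=> //; apply: lt0r_neq0; nra.
Unshelve. all: by end_near. Qed.
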